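(* For all $k\geq 2$, the set of $\bar\alpha=(\alpha_1,\dots,\alpha_k)\in\mathrm{Aut}(\mathcal R)^k$ such that $\langle\bar\alpha\rangle$ is a free group with basis $\bar\alpha$ and the action $\langle\bar\alpha\rangle\curvearrowright\mathcal{R}$ is homogeneous with all orbits infinite is a dense $G_\delta$ in $\mathcal{A}_k$.
   Context: The Random Graph $\mathcal R$ is the unique (up to isomorphism) countably infinite simple undirected graph such that for all disjoint finite sets $U,W$ of vertices there is a vertex $z\notin U\cup W$ adjacent to every vertex of $U$ and to no vertex of $W$. $\mathrm{Aut}(\mathcal R)$ carries the topology of pointwise convergence on the (discrete) vertex set, for which it is a Polish group. A subgroup $G<\mathrm{Aut}(\mathcal R)$ acts homogeneously if for every graph isomorphism $\varphi:U\to W$ between finite induced subgraphs of $\mathcal R$ there is $g\in G$ with $g u=\varphi(u)$ for all $u\in U$. Orbits refer to the action on vertices. For $\bar\alpha=(\alpha_1,\dots,\alpha_k)\in\mathrm{Aut}(\mathcal R)^k$, $\langle\bar\alpha\rangle$ is the subgroup of $\mathrm{Aut}(\mathcal R)$ generated by $\alpha_1,\dots,\alpha_k$, and $$\mathcal{A}_k:=\{\bar\alpha\in\mathrm{Aut}(\mathcal R)^k : \langle\bar\alpha\rangle\curvearrowright\mathcal R\text{ has all orbits infinite}\},$$ which is closed in $\mathrm{Aut}(\mathcal R)^k$ (product topology) and is given the subspace topology. *)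

(* Defs.v *)
From HB Require Import structures.
From mathcomp Require Import all_boot.
From mathcomp Require Import boolp classical_sets functions cardinality.
From mathcomp Require Import topology borel_hierarchy.

Set Implicit Arguments.
Unset Strict Implicit.
Unset Printing Implicit Defensive.

Local Open Scope classical_set_scope.
Local Open Scope group_scope.

Record graph := Graph {
  vertex :> choiceType ;
  adj : rel vertex ;
  adj_irr : irreflexive adj ;
  adj_sym : symmetric adj }.

(* Such a graph exists and is unique up to isomorphism. *)
Definition is_random_graph (R : graph) : Prop :=
  [/\ countable [set: R], infinite_set [set: R] &
      forall U W : set R, finite_set U -> finite_set W -> U `&` W = set0 ->
      exists z : R, [/\ ~ (U `|` W) z,
        forall u, U u -> adj z u & forall w, W w -> ~~ adj z w]].

Section Automorphisms.
Variable R : graph.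

Definition is_aut : set {ptws R -> discrete_topology R} :=
  [set f | bijective f /\ forall x y : R, adj (f x : R) (f y : R) = adj x y].

(* As a [set_type], [Aut] carries the topology induced by that of pointwise
   convergence. *)
Definition Aut : Type := set_type is_aut.

HB.instance Definition _ := Topological.copy Aut (set_type is_aut).

Definition aut_fun (g : Aut) : R -> R := set_val g.

Lemma aut_bij (g : Aut) : bijective (aut_fun g).
Proof. by have [] := set_mem (valP g). Qed.

Lemma aut_adj (g : Aut) (x y : R) : adj (aut_fun g x) (aut_fun g y) = adj x y.
Proof. by have [_] := set_mem (valP g); apply. Qed.

Lemma aut_eq (g h : Aut) : aut_fun g =1 aut_fun h -> g = h.
Proof. by move=> gh; apply: val_inj; exact/funext. Qed.

Definition mk_aut (f : R -> R) (bf : bijective f)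
    (af : forall x y, adj (f x) (f y) = adj x y) : Aut :=
  exist _ (f : {ptws R -> discrete_topology R}) (mem_set (conj bf af)).

Definition aut1 : Aut := mk_aut (Bijective (frefl id) (frefl id))
  (fun x y => erefl).

Lemma aut_mul_adj (g h : Aut) (x y : R) :
  adj ((aut_fun g \o aut_fun h) x) ((aut_fun g \o aut_fun h) y) = adj x y.
Proof. by rewrite /= !aut_adj. Qed.

Definition aut_mul (g h : Aut) : Aut :=
  mk_aut (bij_comp (aut_bij g) (aut_bij h)) (aut_mul_adj g h).

Lemma aut_inv_subproof (g : Aut) :
  exists f : R -> R, cancel (aut_fun g) f /\ cancel f (aut_fun g).
Proof. by have [f] := aut_bij g; exists f. Qed.

Definition aut_inv_fun (g : Aut) : R -> R := sval (cid (aut_inv_subproof g)).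

Lemma aut_funK (g : Aut) : cancel (aut_fun g) (aut_inv_fun g).
Proof. by rewrite /aut_inv_fun; case: cid => f []. Qed.

Lemma aut_inv_funK (g : Aut) : cancel (aut_inv_fun g) (aut_fun g).
Proof. by rewrite /aut_inv_fun; case: cid => f []. Qed.

Lemma aut_inv_adj (g : Aut) (x y : R) :
  adj (aut_inv_fun g x) (aut_inv_fun g y) = adj x y.
Proof. by rewrite -(aut_adj g) !aut_inv_funK. Qed.

Definition aut_inv (g : Aut) : Aut :=
  mk_aut (Bijective (aut_inv_funK g) (aut_funK g)) (aut_inv_adj g).

Lemma aut_mulA : associative aut_mul.
Proof. by move=> f g h; exact: aut_eq. Qed.

Lemma aut_mul1 : left_id aut1 aut_mul.
Proof. by move=> g; exact: aut_eq. Qed.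

Lemma aut_mul1r : right_id aut1 aut_mul.
Proof. by move=> g; exact: aut_eq. Qed.

Lemma aut_mulV : left_inverse aut1 aut_inv aut_mul.
Proof. by move=> g; apply: aut_eq => x; exact: aut_funK. Qed.

Lemma aut_mulVr : right_inverse aut1 aut_inv aut_mul.
Proof. by move=> g; apply: aut_eq => x; exact: aut_inv_funK. Qed.

HB.instance Definition _ :=
  isGroup.Build Aut aut_mulA aut_mul1 aut_mul1r aut_mulV aut_mulVr.

Definition orbit (H : set Aut) (x : R) : set R := [set aut_fun g x | g in H].

Definition all_orbits_infinite (H : set Aut) : Prop :=
  forall x : R, infinite_set (orbit H x).

Definition homogeneous (H : set Aut) : Prop :=
  forall (U W : set R) (phi : R -> R),
    finite_set U -> finite_set W -> set_bij U W phi ->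
    (forall u v, U u -> U v -> adj (phi u) (phi v) = adj u v) ->
    exists2 g, H g & forall u, U u -> aut_fun g u = phi u.

End Automorphisms.

Section FreeBasis.
Variables (T : groupType) (k : nat).

Definition is_subgroup (H : set T) : Prop :=
  H 1 /\ forall x y, H x -> H y -> H (x / y).

Definition generated (a : 'I_k -> T) : set T := smallest is_subgroup (range a).

(* The letter [(i, true)] stands for the i-th generator and [(i, false)] for
   its inverse. *)
Definition word : Type := seq ('I_k * bool).

Definition reduced (w : word) : bool :=
  sorted (fun l m : 'I_k * bool => ~~ ((l.1 == m.1) && (l.2 != m.2))) w.

Definition eval_word (a : 'I_k -> T) (w : word) : T :=
  \prod_(l <- w) (if l.2 then a l.1 else (a l.1)^-1).

(* The free group on k letters is represented by reduced words: the subgroup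
   generated by [a] is free with basis [a] when each of its elements is the
   value of exactly one reduced word; in particular [a] is then injective. *)
Definition free_with_basis (a : 'I_k -> T) : Prop :=
  forall g, generated a g -> exists! w, reduced w /\ eval_word a w = g.

End FreeBasis.

Definition Aut_power (R : graph) (k : nat) : topologicalType :=
  {ptws 'I_k -> Aut R}.

Definition calA (R : graph) (k : nat) : set (Aut_power R k) :=
  [set a | all_orbits_infinite (generated a)].

(* Density and G_delta are relative to the subspace topology, i.e. that of the
   [set_type] of [A]; the library's [subspace A] is not suitable since there
   the points outside [A] are isolated. *)
Definition dense_Gdelta_in (X : topologicalType) (A S : set X) : Prop :=
  [/\ S `<=` A, dense (set_val @^-1` S : set (set_type A))
    & Gdelta (set_val @^-1` S : set (set_type A))].

(* Main.v *)
(* The theorem follows by building automorphisms from finite approximations. A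
   state is a k-tuple of finite partial isomorphisms of R; it is escaping when
   from every vertex some positive word leaves the domains. The restriction to a
   finite set of a k-tuple with infinite orbits is escaping, because a finite set
   closed under all generators is a union of finite orbits. By genericity of R an
   escaping state can be extended, remaining escaping, so that a given generator
   or its inverse is defined at a given vertex, or so that a given reduced word
   moves some vertex. It can also be extended so that some word realizes a given
   finite partial isomorphism phi : U -> W.  For this let the partial injections
   act freely outside of their domains, adding only the edges that are forced. A
   positive word never comes back once it has left R, so there is a single
   positive word g along which all vertices of R leave. Take s = g g x^N with x a
   generator and N > 2|g|: the points s(U) and s(W) are far away from, and not
   adjacent to, the domain and range of another generator y, hence y may be
   extended by s(u) |-> s(phi(u)), and then s^-1 y s realizes phi. Embedding the
   finitely many points involved in R over the vertices already there gives the
   new state. The limit of a chain of states that meets countably many such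
   requirements is free, and homogeneous, hence has infinite orbits. *)
Require Import Defs.
From mathcomp Require Import all_boot.
From mathcomp Require Import boolp classical_sets functions cardinality.
From mathcomp Require Import topology borel_hierarchy.

Set Implicit Arguments.
Unset Strict Implicit.
Unset Printing Implicit Defensive.

Local Open Scope classical_set_scope.

(** * The extension property of the random graph *)

Section ExtensionProperty.
Variable R : graph.
Hypothesis hR : is_random_graph R.

Lemma random_graph_vertex (D : seq R) (P : pred R) :
  exists2 z, z \notin D & {in D, forall d, adj z d = P d}.
Proof.
have [_ _ h] := hR.
have [||| z [nz zP zN]] := h [set` [seq d <- D | P d]] [set` [seq d <- D | ~~ P d]].
- exact: finite_seq.
- exact: finite_seq.
- rewrite -subset0 => x [] /=.
  by rewrite !mem_filter => /andP[-> _] /andP[].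
exists z.
  apply/negP => zD; apply: nz; case: (boolP (P z)) => Pz; [left|right];
  by rewrite /= mem_filter Pz.
move=> d dD; case: (boolP (P d)) => Pd.
  by apply: zP; rewrite /= mem_filter Pd.
by apply/negbTE/zN; rewrite /= mem_filter Pd.
Qed.

(** The points of [L] are placed one at a time, each new one at a vertex given by the extension
    property. This glues a finite abstract graph over the vertices already occupied by [L0]. *)
Lemma extend_embedding (Y : eqType) (E : rel Y) (L0 L : seq Y) (i0 : Y -> R) :
    irreflexive E -> symmetric E ->
    {in L0 &, injective i0} ->
    {in L0 &, forall p q, adj (i0 p) (i0 q) = E p q} ->
  exists i : Y -> R, [/\ {in L0, i =1 i0}, {in L0 ++ L &, injective i} &
    {in L0 ++ L &, forall p q, adj (i p) (i q) = E p q}].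
Proof.
move=> Eirr Esym; elim: L L0 i0 => [|y L IH] L0 i0 inj0 adj0.
  by exists i0; rewrite cats0.
case: (boolP (y \in L0)) => yL0.
  have memE : L0 ++ y :: L =i L0 ++ L.
    move=> x; rewrite !mem_cat inE.
    by case: eqVneq => // ->; rewrite yL0.
  have [i [i1 i2 i3]] := IH _ _ inj0 adj0.
  by exists i; split=> // p q; rewrite !memE; [exact: i2|exact: i3].
have [z zD zP] := random_graph_vertex (map i0 L0)
  (fun d => has (fun q => (i0 q == d) && E y q) L0).
have zE q : q \in L0 -> adj z (i0 q) = E y q.
  move=> qL; rewrite zP ?map_f //; apply/hasP/idP => [[q' q'L]|Eyq].
    by move=> /andP[/eqP /(inj0 _ _ q'L qL) ->].
  by exists q => //; rewrite eqxx.
have zN q : q \in L0 -> i0 q <> z by move=> qL qz; rewrite -qz map_f in zD.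
pose j q := if q == y then z else i0 q.
have jL q : q \in L0 -> j q = i0 q.
  by rewrite /j; case: eqP => // ->; rewrite (negPf yL0).
have jy : j y = z by rewrite /j eqxx.
have [||i [i1 i2 i3]] := IH (y :: L0) j.
- move=> p q; rewrite !inE => /predU1P[->|pL] /predU1P[->|qL] //.
  + by rewrite jy jL // => /esym/zN.
  + by rewrite jy jL // => /zN.
  + by rewrite !jL //; exact: inj0.
- move=> p q; rewrite !inE => /predU1P[->|pL] /predU1P[->|qL].
  + by rewrite Eirr adj_irr.
  + by rewrite jy jL // zE.
  + by rewrite jy jL // adj_sym zE // Esym.
  + by rewrite !jL //; exact: adj0.
have memE : L0 ++ y :: L =i (y :: L0) ++ L.
  by move=> x; rewrite !(mem_cat, inE) orbCA orbA.
exists i; split=> [q qL|p q|p q].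
- by rewrite i1 ?jL // inE qL orbT.
- by rewrite !memE; exact: i2.
- by rewrite !memE; exact: i3.
Qed.

End ExtensionProperty.

(** * Finite partial isomorphisms and their words *)

Section States.
Variables (R : graph) (k : nat).

(** The equality clause makes the list both single-valued and injective. *)
Definition partial_iso (ps : seq (R * R)) : Prop :=
  {in ps &, forall p q, (p.1 == q.1) = (p.2 == q.2) /\
                        adj p.1 q.1 = adj p.2 q.2}.

Lemma partial_iso_cat (ps qs : seq (R * R)) :
  partial_iso ps -> partial_iso qs ->
  (forall p q, p \in ps -> q \in qs ->
    [/\ p.1 != q.1, p.2 != q.2, ~~ adj p.1 q.1 & ~~ adj p.2 q.2]) ->
  partial_iso (ps ++ qs).
Proof.
move=> hp hq hpq p q; rewrite !mem_cat => /orP[pp|pq] /orP[qp|qq].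
- exact: hp.
- by have [/negPf-> /negPf-> /negPf-> /negPf->] := hpq _ _ pp qq.
- have [] := hpq _ _ qp pq.
  by rewrite !(eq_sym q.1) !(eq_sym q.2) !(adj_sym q.1) !(adj_sym q.2)
    => /negPf-> /negPf-> /negPf-> /negPf->.
- exact: hq.
Qed.

Definition state := 'I_k -> seq (R * R).

Implicit Types (S : state) (w : seq 'I_k) (i : 'I_k) (l : 'I_k * bool).

Definition substate S S' := forall i, {subset S i <= S' i}.

Definition support S : seq R :=
  flatten [seq unzip1 (S i) ++ unzip2 (S i) | i <- enum 'I_k].

Lemma supportP S i x y : (x, y) \in S i -> x \in support S /\ y \in support S.
Proof.
move=> xy; split; apply/flattenP; exists (unzip1 (S i) ++ unzip2 (S i));
  rewrite ?(map_f _ (mem_enum _ _)) // mem_cat; apply/orP; [left|right];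
  by apply/mapP; exists (x, y).
Qed.

(** Positive words are read from left to right: the first letter acts first. *)
Fixpoint ppath S w (x y : R) : Prop :=
  if w is i :: w' then exists2 z, (x, z) \in S i & ppath S w' z y else x = y.

Lemma ppath_cat S w w' x y :
  ppath S (w ++ w') x y -> exists2 z, ppath S w x z & ppath S w' z y.
Proof.
elim: w x => [|i w IH] x /=; first by exists x.
by move=> [z xz /IH[t zt ty]]; exists t => //; exists z.
Qed.

Definition escaping S :=
  forall x, exists w, forall y, ~ ppath S w x y.

Definition admissible S := (forall i, partial_iso (S i)) /\ escaping S.

(** [Z] is a trap. Along [w ++ u], where [w] escapes in [S], a trajectory has entered [Z] by the end
    of [w], stays there, and is stopped by [u]. *)
Lemma escaping_ext S S' (Z : R -> Prop) (u : seq 'I_k) :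
  escaping S ->
  (forall i x y, (x, y) \in S' i -> (x, y) \in S i \/ Z y) ->
  (forall i x y, (x, y) \in S' i -> Z x -> Z y) ->
  (forall z, Z z -> forall y, ~ ppath S' u z y) ->
  escaping S'.
Proof.
move=> hS h1 h2 h3 x; have [w hw] := hS x.
exists (w ++ u) => y /ppath_cat[z wz]; apply: h3.
have Zp v a b : Z a -> ppath S' v a b -> Z b.
  by elim: v a => [|i v IH] a Za /=; [move=> <-|move=> [c /h2/(_ Za)/IH]; apply].
have : ppath S w x z \/ Z z.
  elim: w x wz {hw} => [|i w IH] x /=; first by left.
  move=> [t xt tz]; case: (h1 _ _ _ xt) => [xtS|Zt].
    by case: (IH _ tz) => ?; [left; exists t|right].
  by right; exact: Zp tz.
by case=> // /hw.
Qed.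

Implicit Type t : word k.

Definition sstep S l x y : Prop :=
  if l.2 then (x, y) \in S l.1 else (y, x) \in S l.1.

(* As in a product of automorphisms, the last letter of a signed word acts
   first. *)
Fixpoint spath S t (x y : R) : Prop :=
  if t is l :: t' then exists2 z, spath S t' x z & sstep S l z y else x = y.

Definition flip l := (l.1, ~~ l.2).

Lemma flipK : involutive flip.
Proof. by move=> [i b]; rewrite /flip /= negbK. Qed.

Definition winv t : word k := rev (map flip t).

Lemma sstep_flip S l x y : sstep S l x y -> sstep S (flip l) y x.
Proof. by case: l => i []. Qed.

Lemma spath_cat S t t' x y z :
  spath S t' x y -> spath S t y z -> spath S (t ++ t') x z.
Proof.
move=> xy; elim: t z => [|l t IH] z /=; first by move=> <-.
by move=> [u /IH h lz]; exists u.
Qed.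

Lemma spath_inv S t x y : spath S t x y -> spath S (winv t) y x.
Proof.
elim: t y => [|l t IH] y /=; first by move=> ->.
move=> [z /IH h /sstep_flip lz]; rewrite /winv /= rev_cons -cats1.
by apply: spath_cat h; exists y.
Qed.

Lemma spath_sub S S' t x y : substate S S' -> spath S t x y -> spath S' t x y.
Proof.
move=> SS'; elim: t y => [|[i b] t IH] y //= [z /IH h hz]; exists z => //.
by case: b hz; exact: SS'.
Qed.

End States.

(** * The free completion of a state to total injections *)

Section FreeCompletion.
Variables (R : graph) (k : nat) (S : state R k).
Hypothesis hS : forall i, partial_iso (S i).

Implicit Types (i l : 'I_k) (p q : R * seq 'I_k) (v w : seq 'I_k).

Definition peval i (x : R) : option R :=
  ohead [seq e.2 | e <- S i & e.1 == x].

Lemma pevalP i x y : peval i x = Some y <-> (x, y) \in S i.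
Proof.
have inS e : e \in [seq e <- S i | e.1 == x] -> (x, e.2) \in S i.
  by rewrite mem_filter => /andP[/eqP<-]; case: e.
rewrite /peval; split.
  case E : [seq e <- S i | e.1 == x] => [//|e s] /= [<-].
  by apply: inS; rewrite E mem_head.
move=> xy; have : (x, y) \in [seq e <- S i | e.1 == x].
  by rewrite mem_filter /= eqxx.
case E : [seq e <- S i | e.1 == x] => [//|e s] _ /=.
have pS : (x, e.2) \in S i by apply: inS; rewrite E mem_head.
by have [/= /esym] := hS pS xy; rewrite eqxx => /eqP ->.
Qed.

(* A pair [(c, w)] whose word [w] is empty or begins with a letter undefined at
   [c] stands for the point [w c] of the free completion of [S] to total
   injections; [c] is the last point of its trajectory to be a vertex of [R]. *)
Definition act p i : R * seq 'I_k :=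
  if nilp p.2 then
    if peval i p.1 is Some d then (d, [::]) else (p.1, [:: i])
  else (p.1, rcons p.2 i).

Definition acts p w := foldl act p w.

Definition nf (x : R) w := acts (x, [::]) w.

Lemma nf_rcons x w i : nf x (rcons w i) = act (nf x w) i.
Proof. exact: foldl_rcons. Qed.

Lemma nf_cat x v w : nf x (v ++ w) = acts (nf x v) w.
Proof. exact: foldl_cat. Qed.

Lemma act_nil p i d : act p i = (d, [::]) ->
  exists2 c, p = (c, [::]) & (c, d) \in S i.
Proof.
case: p => c w; rewrite /act /=; case: w => [|j w] //=.
by case E: (peval i c) => [e|] // [<-]; exists c => //; exact/pevalP.
Qed.

Lemma act_cons p i : ~~ nilp p.2 -> act p i = (p.1, rcons p.2 i).
Proof. by rewrite /act => /negPf ->. Qed.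

Lemma acts_cons p w : ~~ nilp p.2 -> acts p w = (p.1, p.2 ++ w).
Proof.
elim: w p => [|i w IH] p hp /=; first by rewrite cats0; case: p hp.
by rewrite act_cons // IH /= ?cat_rcons //; case: (p.2).
Qed.

Lemma act_last p i j : ~~ nilp (act p i).2 -> last j (act p i).2 = i.
Proof.
rewrite /act; case: (nilp p.2); first by case: peval.
by rewrite last_rcons.
Qed.

(** A defined letter gives an empty word and is injective because [S i] is; an undefined one appends
    [i], which can be undone. Emptiness of the word tells the two cases apart. *)
Lemma act_inj i : injective (act^~ i).
Proof.
move=> [c v] [d w] /=; rewrite /act /=.
case: v => [|a v]; case: w => [|b w] /=.
- case E: (peval i c) => [e|]; case F: (peval i d) => [f|] // [ef];
    last by rewrite ef.
  move: E F => /pevalP E /pevalP F; rewrite ef in E.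
  by have [/= ] := hS E F; rewrite eqxx => /eqP ->.
- by case: peval => // [[_ _]]; case: w.
- by case: peval => // [[_ _]]; case: v.
- by move=> [-> -> /rcons_inj[->]].
Qed.

Lemma nf_inj w : injective (nf^~ w).
Proof.
elim/last_ind: w => [|w i IH] x y /=; first by case.
by rewrite !nf_rcons => /act_inj /IH.
Qed.

Lemma size_nf x w : size (nf x w).2 <= size w.
Proof.
elim/last_ind: w => [//|w i IH]; rewrite nf_rcons size_rcons /act.
case: (nilp _.2); first by case: peval.
by rewrite /= size_rcons.
Qed.

Lemma nf_suffix x w : exists u, w = u ++ (nf x w).2.
Proof.
elim/last_ind: w => [|w i [u IH]]; first by exists [::].
rewrite nf_rcons /act; case: nilP => [E|_] /=; last first.
  by exists u; rewrite -rcons_cat -IH.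
case: peval => [d|] /=; first by exists (rcons w i); rewrite cats0.
by exists w; rewrite cats1.
Qed.

Lemma nf_ppath x w d : nf x w = (d, [::]) -> ppath S w x d.
Proof.
elim: w x => [|i w IH] x /=; first by case.
have -> : nf x (i :: w) = acts (act (x, [::]) i) w by [].
rewrite /act /=; case E: peval => [e|].
  by move=> /IH h; exists e => //; exact/pevalP.
by rewrite acts_cons.
Qed.

(* The least graph structure on the free completion that extends [R] and is
   preserved by the letters. *)
Definition cadj p q : bool :=
  `[< exists v c d, [/\ adj c d, nf c v = p & nf d v = q] >].

Lemma cadj_irr : irreflexive cadj.
Proof.
move=> p; apply/asboolP => -[v [c [d [cd <- /nf_inj dc]]]].
by rewrite dc adj_irr in cd.
Qed.

Lemma cadj_sym : symmetric cadj.
Proof.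
by move=> p q; apply/asboolP/asboolP => -[v [c [d [cd <- <-]]]];
  exists v, d, c; rewrite adj_sym.
Qed.

(** A trajectory that ends in [R] never left it, so each step is a pair of the state and preserves
    adjacency. *)
Lemma adj_nf_nil v c d e f :
  nf c v = (e, [::]) -> nf d v = (f, [::]) -> adj e f = adj c d.
Proof.
elim/last_ind: v e f => [|v i IH] e f; first by case=> -> [->].
rewrite !nf_rcons => /act_nil[e' E eS] /act_nil[f' F fS].
by have [/= _ <-] := hS eS fS; exact: IH.
Qed.

Lemma cadj_nil c d : cadj (c, [::]) (d, [::]) = adj c d.
Proof.
apply/asboolP/idP => [[v [e [f [ef ce df]]]]|cd].
  by rewrite (adj_nf_nil ce df).
by exists [::], c, d.
Qed.

(** For the descent from the images to [p] and [q]: if an image lies outside [R], the word [v]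
    producing the edge ends with [i], and injectivity cancels this letter; if both lie in [R], the
    steps are pairs of [S i]. *)
Lemma cadj_act p q i : cadj (act p i) (act q i) = cadj p q.
Proof.
apply/idP/idP; last first.
  move=> /asboolP[v [c [d [cd <- <-]]]]; apply/asboolP.
  by exists (rcons v i), c, d; rewrite !nf_rcons.
have [/nilP pN|pN] := boolP (nilp (act p i).2);
  have [/nilP qN|qN] := boolP (nilp (act q i).2); first 1 last.
1-3: move=> /asboolP[v [c [d [cd]]]]; elim/last_ind: v => [|v j _];
  first by move=> cE dE; move: pN qN; rewrite -cE -dE.
1-3: rewrite !nf_rcons => hp hq.
1-3: have ij : j = i by
  [have := pN; rewrite -hp => /(act_last i) <-; rewrite hp act_last
  |have := qN; rewrite -hq => /(act_last i) <-; rewrite hq act_last].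
1-3: rewrite {}ij in hp hq; apply/asboolP; exists v, c, d.
1-3: by split=> //; [exact: act_inj hp|exact: act_inj hq].
move: pN qN; case pE: (act p i) => [e ?]; case qE: (act q i) => [f ?] /= ??; subst.
rewrite cadj_nil; have [e' -> eS] := act_nil pE; have [f' -> fS] := act_nil qE.
by have [/= _ <-] := hS eS fS; rewrite cadj_nil.
Qed.

Lemma cadj_nf v c d : cadj (nf c v) (nf d v) = adj c d.
Proof.
elim/last_ind: v => [|v i IH]; first exact: cadj_nil.
by rewrite !nf_rcons cadj_act.
Qed.

(** A point outside [R] stays outside, so escape words can be concatenated, each chosen for the
    position to which the previous ones have brought the next vertex of the support. *)
Lemma common_escape (i0 : 'I_k) : escaping S ->
  exists g, forall x, ~~ nilp (nf x g).2.
Proof.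
move=> eS.
have nfC x g h : ~~ nilp (nf x g).2 -> ~~ nilp (nf x (g ++ h)).2.
  by move=> hx; rewrite nf_cat acts_cons //; case: (nf x g).2 hx.
have [g hg] : exists g, {in support S, forall x, ~~ nilp (nf x g).2}.
  elim: (support S) => [|c C [g IH]]; first by exists [::].
  case E : (nf c g) => [d [|a w]]; last first.
    by exists g => x; rewrite inE => /predU1P[->|/IH //]; rewrite E.
  have [h hh] := eS d; exists (g ++ h) => x; rewrite inE => /predU1P[->|/IH /nfC //].
  rewrite nf_cat E; apply/negP => /nilP N; apply: (hh (nf d h).1).
  by apply: nf_ppath; move: N; rewrite -/(nf d h); case: nf => a b /= ->.
(* The extra letter makes the word nonempty: a vertex outside the support leaves at the first
   letter, whatever it is. *)
exists (rcons g i0) => x.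
have [xC|xC] := boolP (x \in support S).
  by rewrite -cats1 nfC // hg.
have xN i : act (x, [::]) i = (x, [:: i]).
  rewrite /act /=; case E: peval => [d|] //; move/pevalP: E => E.
  by have [] := supportP E; rewrite (negPf xC).
case: g {hg} => [|j g]; first by rewrite /nf /= xN.
have -> : nf x (rcons (j :: g) i0) = acts (act (x, [::]) j) (rcons g i0) by [].
by rewrite xN acts_cons.
Qed.

End FreeCompletion.

(** * Realizing a finite partial isomorphism by a word *)

Section Homogeneity.
Variables (R : graph) (k : nat) (S : state R k) (i1 i2 : 'I_k).
Hypothesis hR : is_random_graph R.
Hypothesis i12 : i1 != i2.
Hypothesis admS : admissible S.
Variable ps : seq (R * R).
Hypothesis hps : partial_iso ps.

Lemma homogeneous_extension : exists S' : state R k,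
  [/\ substate S S', admissible S' &
      exists t, forall p, p \in ps -> spath S' t p.1 p.2].
Proof.
have [hS eS] := admS.
have [g hg] := common_escape hS i1 eS.
(* [M] will bound the words of all points where [i2] is defined before [new] is added, and of their
   images; the tail, made of [i1] only, is longer. *)
pose M := size (g ++ g).
pose tl := nseq M.+1 i1.
have size_tl : size tl = M.+1 by rewrite size_nseq.
pose s := (g ++ g) ++ tl.
pose F := [seq p.1 | p <- ps] ++ [seq p.2 | p <- ps].
pose core := F ++ support S.
pose L0 : seq (R * seq 'I_k) := [seq (c, [::]) | c <- core].
pose L := [seq nf S f (take n s) | f <- F, n <- iota 0 (size s).+1].
have L0P q : q \in L0 -> q = (q.1, [::]) by case/mapP => c _ ->.
have inj0 : {in L0 &, injective (@fst R (seq 'I_k))}.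
  by move=> p q /L0P -> /L0P -> /= ->.
have adj0 : {in L0 &, forall p q, adj p.1 q.1 = cadj S p q}.
  by move=> p q /L0P -> /L0P ->; rewrite cadj_nil.
have [io [io0 ioI ioA]] :=
  extend_embedding hR L (cadj_irr hS) (cadj_sym S) inj0 adj0.
have coreS i x y : (x, y) \in S i -> (x \in core) /\ (y \in core).
  by move=> /supportP[xS yS]; rewrite !mem_cat xS yS !orbT.
have ioc c : c \in core -> io (c, [::]) = c.
  by move=> cc; rewrite io0 // map_f.
have inL0 c : c \in core -> (c, [::]) \in L0 ++ L.
  by move=> cc; rewrite mem_cat map_f.
have inL f n : f \in F -> n <= size s -> nf S f (take n s) \in L0 ++ L.
  move=> fF ns; rewrite mem_cat; apply/orP; right.
  by apply/allpairsP; exists (f, n); rewrite mem_iota add0n ltnS.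
have sizeL q : q \in L0 ++ L -> size q.2 <= size s.
  rewrite mem_cat => /orP[/L0P->//|/allpairsP[[f n] /= [_ _ ->]]].
  by rewrite (leq_trans (size_nf _ _ _)) // size_take_min geq_minr.
(* The letter [i] is kept on its old domain and at the points of the trajectories along [s] where
   the next letter is [i]. *)
pose dom i : seq (R * seq 'I_k) := [seq (e.1, [::]) | e <- S i] ++
  [seq nf S f (take n s) | f <- F, n <- [seq n <- iota 0 (size s) | nth i1 s n == i]].
have domP i q : q \in dom i ->
    (exists x y, (x, y) \in S i /\ q = (x, [::])) \/
    (exists f n, [/\ f \in F, n < size s, nth i1 s n = i & q = nf S f (take n s)]).
  rewrite mem_cat => /orP[/mapP[[x y] /= xy ->]|]; first by left; exists x, y.
  move=> /allpairsP[[f n] /= []]; rewrite mem_filter mem_iota add0n.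
  by move=> fF /andP[/eqP sn ns] ->; right; exists f, n.
have act_nf f n : n < size s -> act S (nf S f (take n s)) (nth i1 s n) =
    nf S f (take n.+1 s).
  by move=> ns; rewrite (take_nth i1) // nf_rcons.
have act_S i x y : (x, y) \in S i -> act S (x, [::]) i = (y, [::]).
  by move=> xy; rewrite /act /=; have /pevalP -> := xy.
have domL i q : q \in dom i -> q \in L0 ++ L /\ act S q i \in L0 ++ L.
  case/domP => [[x [y [xy ->]]]|[f [n [fF ns <- ->]]]].
    by have [xc yc] := coreS _ _ _ xy; rewrite (act_S _ _ _ xy) !inL0.
  by rewrite act_nf // !inL // ltnW.
have sizeE q : ~~ nilp (acts S q g).2.
  case: q => c w; have [/nilP /= ->|wN] := boolP (nilp (c, w).2); first exact: hg.
  by rewrite acts_cons //=; case: w wN.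
pose z f := nf S f s.
(* The first copy of [g] has already left [R], so the second copy and the tail are recorded in
   full. *)
have zE f : exists2 w, ~~ nilp w & (z f).2 = w ++ g ++ tl.
  exists (nf S f g).2; first exact: hg.
  by rewrite /z /s -catA nf_cat acts_cons.
have zsize f : M < size (z f).2.
  have [w _ ->] := zE f; rewrite !size_cat size_tl addnA.
  by rewrite (leq_trans _ (leq_addl _ _)).
have zN f : ~~ nilp (z f).2 by rewrite /nilp; case: size (zsize f).
(* An edge at [z f] comes from a word [v] ending with [g ++ tl]. This [g] drives the other endpoint
   out of [R] too, so its word contains the whole tail and is longer than [M]. *)
have zadj f q : size q.2 <= M -> cadj S (z f) q = false.
  move=> qM; apply/negbTE/asboolP => -[v [c [d [_ cv dv]]]].
  have [u] := nf_suffix S c v; rewrite cv; have [w _ ->] := zE f => vE.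
  move: dv qM; rewrite vE !catA nf_cat nf_cat acts_cons; last exact: sizeE.
  by move=> <- /=; rewrite size_cat size_tl leqNgt (leq_trans _ (leq_addl _ _)).
have zL f : f \in F -> z f \in L0 ++ L.
  by move=> fF; rewrite /z -(take_size s) inL.
pose S1 i := [seq (io q, io (act S q i)) | q <- dom i].
pose new := [seq (io (z p.1), io (z p.2)) | p <- ps].
pose S2 : state R k := fun i => if i == i2 then S1 i ++ new else S1 i.
have S12 i : {subset S1 i <= S2 i}.
  by move=> e eS1; rewrite /S2; case: eqP => // _; rewrite mem_cat eS1.
have S01 i : {subset S i <= S1 i}.
  move=> [x y] xy; have [xc yc] := coreS _ _ _ xy.
  apply/mapP; exists (x, [::]); last by rewrite (act_S _ _ _ xy) !ioc.
  by rewrite mem_cat; apply/orP; left; apply/mapP; exists (x, y).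
have pF p : p \in ps -> p.1 \in F /\ p.2 \in F.
  by move=> pp; rewrite !mem_cat !map_f // orbT.
have S2P i e : e \in S2 i -> e \in S1 i \/ i == i2 /\ e \in new.
  by rewrite /S2; case: (i == i2); [rewrite mem_cat => /orP[]; [left|right]|left].
(* The tail has no [i2], so [s] reads [i2] only among its first [M] letters. *)
have dom2 q : q \in dom i2 -> size q.2 <= M /\ size (act S q i2).2 <= M.
  case/domP => [[x [y [/act_S E ->]]]|[f [n [fF ns sn ->]]]]; first by rewrite E.
  have nM : n < M.
    rewrite ltnNge; apply/negP => Mn; move: sn ns.
    rewrite nth_cat -/M ltnNge Mn /= nth_nseq size_cat size_tl => + h.
    by rewrite ltn_subLR // h => /eqP; rewrite (negPf i12).
  rewrite -sn act_nf //; split; apply: (leq_trans (size_nf _ _ _));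
    by rewrite size_take_min geq_min ?nM // ltnW.
have zfar f q : f \in F -> q \in L0 ++ L -> size q.2 <= M ->
    io q != io (z f) /\ ~~ adj (io q) (io (z f)).
  move=> fF qL qM; rewrite ioA ?zL // cadj_sym zadj //; split=> //.
  apply/eqP => /ioI -/(_ qL (zL _ fF)) qz.
  by move: (zsize f); rewrite -qz ltnNge qM.
exists S2; split; first by move=> i e /S01 /S12.
  split=> [i|].
    have iso1 j : partial_iso (S1 j).
      move=> e e' /mapP[p /domL[pL paL] ->] /mapP[q /domL[qL qaL] ->] /=.
      rewrite !ioA // cadj_act // !(inj_in_eq ioI) //.
      by rewrite (inj_eq (act_inj hS (i:=j))).
    rewrite /S2; case: eqP => // ->; apply: partial_iso_cat => //.
    (* Reading [s] is injective and preserves both adjacency and nonadjacency, so [new] is a copy of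
       [ps]. *)
    - move=> _ _ /mapP[p pp ->] /mapP[q qp ->] /=.
      have [[p1 p2] [q1 q2]] := (pF _ pp, pF _ qp).
      rewrite !ioA ?zL // !cadj_nf // !(inj_in_eq ioI) ?zL //.
      by rewrite !(inj_eq (nf_inj hS (w:=s))); exact: hps.
    - move=> _ _ /mapP[q qd ->] /mapP[p /pF[p1 p2] ->] /=.
      have [[qL qaL] [qM qaM]] := (domL _ _ qd, dom2 _ qd).
      by have [[? ?] [? ?]] := (zfar _ _ p1 qL qM, zfar _ _ p2 qaL qaM).
  (* The trap consists of the images of points with nonempty word. As [new] concerns only [i2], each
     step by [i1] there lengthens the word, which never exceeds [size s] letters. *)
  apply: (escaping_ext eS (Z := fun y => exists2 q, q \in L0 ++ L & ~~ nilp q.2 /\ y = io q)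
     (u := nseq (size s).+1 i1)).
  - move=> i x y /S2P[/mapP[q qd [-> ->]]|[_ /mapP[p /pF[_ p2] [_ ->]]]]; last first.
      by right; exists (z p.2); rewrite ?zL.
    have [qL qaL] := domL _ _ qd.
    have [/nilP N|N] := boolP (nilp (act S q i).2); last by right; exists (act S q i).
    left; move: N; case aE: (act S q i) => [d w] /= wN; rewrite {}wN in aE *.
    have [c -> cd] := act_nil hS aE; have [cc dc] := coreS _ _ _ cd.
    by rewrite !ioc.
  - move=> i x y /S2P[/mapP[q qd [-> ->]]|[_ /mapP[p /pF[_ p2] [_ ->]]]]; last first.
      by move=> _; exists (z p.2); rewrite ?zL.
    have [qL qaL] := domL _ _ qd.
    move=> [q' q'L [q'N /ioI -/(_ qL q'L) qq']]; exists (act S q i) => //; split=> //.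
    by rewrite act_cons qq' // /nilp size_rcons.
  - suff long n q y : q \in L0 ++ L -> ~~ nilp q.2 -> ppath S2 (nseq n i1) (io q) y ->
        exists2 q', q' \in L0 ++ L & n + size q.2 <= size q'.2.
      move=> _ [q qL [qN ->]] y /(long _ _ _ qL qN)[q' /sizeL q's /leq_trans/(_ q's)].
      by rewrite addSn ltnNge leq_addr.
    elim: n q => [|n IH] q qL qN; first by exists q.
    move=> /= [x /S2P]; rewrite (negPf i12).
    move=> [/mapP[q' q'd [qq' ->]]|[]//].
    have [q'L q'aL] := domL _ _ q'd; rewrite -(ioI _ _ qL q'L qq') in q'aL *.
    move=> /(IH _ q'aL); rewrite act_cons // /nilp size_rcons => /(_ isT).
    by rewrite addnS.
(* Signed words apply their last letter first, hence the reversal. *)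
have steps f n : f \in F -> n <= size s ->
    spath S2 [seq (i, true) | i <- rev (take n s)] f (io (nf S f (take n s))).
  move=> fF; elim: n => [|n IH] ns.
    by rewrite take0 /= ioc // mem_cat fF.
  rewrite (take_nth i1) // rev_rcons nf_rcons /=.
  exists (io (nf S f (take n s))); first exact: IH (ltnW ns).
  apply: S12; apply/mapP; exists (nf S f (take n s)) => //.
  rewrite mem_cat; apply/orP; right; apply/allpairsP; exists (f, n); split=> //=.
  by rewrite mem_filter eqxx mem_iota.
pose t := [seq (i, true) | i <- rev s].
have tz f : f \in F -> spath S2 t f (io (z f)).
  by move=> fF; have := steps f _ fF (leqnn _); rewrite take_size.
exists (winv t ++ (i2, true) :: t) => p pp; have [p1 p2] := pF _ pp.
apply: (spath_cat _ (spath_inv (tz _ p2))); exists (io (z p.1)); first exact: tz.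
by rewrite /sstep /= /S2 eqxx mem_cat (map_f _ pp) orbT.
Qed.

End Homogeneity.

(** * One-point extensions and freeness *)

Section PointExtension.
Variables (R : graph) (k : nat).
Hypothesis hR : is_random_graph R.
Implicit Types (S : state R k) (t : word k) (l : 'I_k * bool).

(** The vertex [y] copies over the range the adjacencies of [x] over the domain. *)
Lemma partial_iso_cons (ps : seq (R * R)) (x : R) (D : seq R) :
  partial_iso ps -> x \notin unzip1 ps ->
  exists2 y, y \notin D & partial_iso ((x, y) :: ps).
Proof.
move=> hps xps; have [y yD yP] := random_graph_vertex hR (D ++ unzip2 ps)
  (fun d => has (fun e => (e.2 == d) && adj x e.1) ps).
move: yD; rewrite mem_cat negb_or => /andP[yD yps]; exists y => //.
have yE e : e \in ps -> adj y e.2 = adj x e.1.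
  move=> eps; rewrite yP ?mem_cat ?map_f ?orbT //.
  apply/hasP/idP => [[e' e'ps /andP[e'e]]|xe]; last by exists e; rewrite ?eqxx.
  by have [+ _] := hps _ _ e'ps eps; rewrite e'e => /eqP ->.
have neq e : e \in ps -> (x == e.1) = false /\ (y == e.2) = false.
  by move=> eps; split; apply/eqP => E; move: xps yps; rewrite E map_f // E map_f.
move=> e e'; rewrite !inE => /predU1P[->|eps] /predU1P[->|e'ps] /=.
- by rewrite !eqxx !adj_irr.
- by have [-> ->] := neq _ e'ps; rewrite yE.
- have [h h'] := neq _ eps; rewrite eq_sym h eq_sym h'.
  by rewrite adj_sym (adj_sym e.2) yE.
- exact: hps.
Qed.

Definition swap (e : R * R) := (e.2, e.1).

Lemma swapK : involutive swap. Proof. by case. Qed.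

Lemma partial_iso_swap (ps : seq (R * R)) :
  partial_iso ps -> partial_iso (map swap ps).
Proof.
by move=> hps _ _ /mapP[e eps ->] /mapP[e' e'ps ->]; have [] := hps _ _ eps e'ps.
Qed.

Lemma support_sstep S l x y : sstep S l x y -> x \in support S.
Proof. by case: l => i [] /= /supportP[]. Qed.

(** As [y] is taken outside the support, the only letter defined there leads back to [x]; this
    allows a reduced word to be followed letter by letter. *)
Lemma point_extension S l x (D : seq R) :
  admissible S -> (forall y, ~ sstep S l x y) ->
  exists S' y, [/\ y \notin D, substate S S', admissible S', sstep S' l x y &
    forall m z, sstep S' m y z -> m = flip l].
Proof.
case: l => i b [hS eS] hx.
have [y [yD yps]] : exists y, y \notin x :: D ++ support S /\
    partial_iso ((if b then (x, y) else (y, x)) :: S i).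
  case: b hx => /= hx.
    have [|y] := @partial_iso_cons (S i) x (x :: D ++ support S) (hS i).
      by apply/mapP => -[[x' y] xy /= xx']; apply: (hx y); rewrite xx'.
    by exists y.
  have [|y yD] := @partial_iso_cons (map swap (S i)) x (x :: D ++ support S)
      (partial_iso_swap (hS i)).
    apply/mapP => -[_ /mapP[[y x'] xy ->] /= xx']; apply: (hx y).
    by rewrite /sstep /= xx'.
  by move=> /partial_iso_swap; rewrite /= (mapK swapK); exists y.
move: yD; rewrite inE mem_cat !negb_or => /and3P[yx yD yS].
set e := if b then _ else _ in yps.
pose S' j := if j == i then e :: S j else S j.
have S'P j a c : (a, c) \in S' j -> (a, c) \in S j \/ j = i /\ (a, c) = e.
  rewrite /S'; case: eqP => [->|_]; last by left.
  by rewrite inE => /predU1P[->|]; [right|left].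
have yN j c : (y, c) \in S j -> False by move=> /supportP[]; rewrite (negPf yS).
have yN2 j c : (c, y) \in S j -> False by move=> /supportP[_]; rewrite (negPf yS).
exists S', y; split=> //.
- by move=> j a aS; rewrite /S'; case: eqP => // _; rewrite inE aS orbT.
- split=> [j|]; first by rewrite /S'; case: eqP => // ->.
  case: b @e {yps hx} S' S'P => e S' S'P.
    have yN' j c : (y, c) \in S' j -> False.
      by move=> /S'P[/yN//|[_ [/eqP]]]; rewrite (negPf yx).
    (* With a positive letter [y] is a dead end, stopped by any letter. *)
    apply: (escaping_ext eS (Z := eq y) (u := [:: i])).
    + by move=> j a c /S'P[|[_ [_ ->]]]; [left|right].
    + by move=> j a c h ya; move: h; rewrite -ya => /yN'.
    + by move=> _ <- c /= [? /yN'].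
  (* With an inverse letter the new pair goes from [y] to [x] and [y] is in no range: trajectories
     from other points are old, and those from [y] continue from [x]. *)
  have old w a c : a != y -> ppath S' w a c -> ppath S w a c.
    elim: w a => [|j w IH] a ay //= [d /S'P[adS|[_ [/eqP]]]]; last first.
      by rewrite (negPf ay).
    move/IH => h; exists d => //; apply: h; apply/eqP => dy.
    by move: adS; rewrite dy => /yN2.
  move=> a; have [->|ay] := eqVneq a y.
    have [w hw] := eS x; exists (i :: w) => c /= [d /S'P[/yN//|[_ [->]]]].
    by move/old; rewrite eq_sym yx => /(_ isT) /hw.
  by have [w hw] := eS a; exists w => c /(old _ _ _ ay) /hw.
- by rewrite /sstep /S' /= eqxx /e; case: (b); rewrite inE eqxx.
- move=> [j c] z; rewrite /sstep /flip /=.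
  case: c => /S'P; [move=> [/yN//|[-> ]]|move=> [/yN2//|[-> ]]];
    rewrite /e; case: (b) => // -[]; first by move/eqP; rewrite (negPf yx).
  by move=> _ /eqP; rewrite (negPf yx).
Qed.

Lemma step_extension S l x : admissible S ->
  exists S', [/\ substate S S', admissible S' & exists y, sstep S' l x y].
Proof.
move=> aS; have [[y xy]|N] := pselect (exists y, sstep S l x y).
  by exists S; split=> [i e| |] //; exists y.
have [|S' [y [_ SS' aS' xy _]]] := @point_extension S l x [::] aS.
  by move=> y xy; apply: N; exists y.
by exists S'; split=> //; exists y.
Qed.

(** From a start outside the support, each letter leads to a fresh vertex other than [x]. Only the
    inverse of the letter just used is defined there, and in a reduced word it is not the next
    letter. *)
Lemma free_extension S t : admissible S -> reduced t -> t != [::] ->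
  exists S', [/\ substate S S', admissible S' &
    exists x y, spath S' t x y /\ x != y].
Proof.
move=> aS rt t0; have [x xS _] := random_graph_vertex hR (support S) xpredT.
suff [S' [y [SS' aS' xy _ xN]]] : exists S' y, [/\ substate S S',
    admissible S', spath S' t x y,
    forall m z, sstep S' m y z -> ohead t = Some (flip m) &
    t != [::] -> x != y].
  by exists S'; split=> //; exists x, y; split=> //; exact: xN.
elim: t rt {t0} => [|l t IH] rt.
  by exists S, x; split=> // [i e|m z /support_sstep] //; rewrite (negPf xS).
have [S1 [y [SS1 aS1 xy yt _]]] := IH (path_sorted rt).
have [|S2 [z [zx S12 aS2 yz zl]]] := @point_extension S1 l y [:: x] aS1.
  move=> z /yt; case: t rt {IH xy yt} => //= m t /andP[+ _] [E].
  by rewrite E /= eqxx; case: (l.2).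
exists S2, z; split=> //.
- by move=> i e /SS1/S12.
- by exists y => //; exact: spath_sub xy.
- by move=> m u /zl ->; rewrite flipK.
- by rewrite mem_seq1 eq_sym in zx.
Qed.

End PointExtension.

(** * Automorphisms as limits of chains of states *)

Section Limit.
Variables (R : graph) (k : nat).

Lemma generic_chain (P : nat -> state R k -> Prop) (S0 : state R k) :
  (forall n S, admissible S ->
     exists S', [/\ substate S S', admissible S' & P n S']) ->
  admissible S0 ->
  exists s : nat -> state R k, [/\ s 0 = S0,
    forall n, substate (s n) (s n.+1), forall n, admissible (s n) &
    forall n, P n (s n.+1)].
Proof.
move=> hP aS0.
have /choice[f hf] (p : nat * state R k) : exists S', admissible p.2 ->
    [/\ substate p.2 S', admissible S' & P p.1 S'].
  case: p => n S; have [/(hP n)[S' ?]|N] := pselect (admissible S).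
    by exists S'.
  by exists S.
pose s := fix s n := if n is m.+1 then f (m, s m) else S0.
have as_ n : admissible (s n) by elim: n => //= n /(hf (n, s n))[].
by exists s; split=> // n; have [] := hf (n, s n) (as_ n).
Qed.

(** Positive letters in [tot] make the union of the chain total, inverse letters make it onto; any
    two pairs lie in a common state, whence injectivity and adjacency. *)
Lemma chain_limit (s : nat -> state R k) :
  (forall n, substate (s n) (s n.+1)) ->
  (forall n, admissible (s n)) ->
  (forall l x, exists n y, sstep (s n) l x y) ->
  exists b : 'I_k -> Aut R, forall n i x y,
    (x, y) \in s n i -> aut_fun (b i) x = y.
Proof.
move=> sS as_ tot.
have mono m n i : m <= n -> {subset s m i <= s n i}.
  move=> /subnK <-; elim: (n - m) => [|d IH] // e /IH; exact: sS.
have iso i m n e e' : e \in s m i -> e' \in s n i ->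
    (e.1 == e'.1) = (e.2 == e'.2) /\ adj e.1 e'.1 = adj e.2 e'.2.
  move=> /(mono _ _ _ (leq_maxl m n)) h /(mono _ _ _ (leq_maxr m n)) h'.
  by have [/(_ i _ _ h h')] := as_ (maxn m n).
have /choice[f hf] : forall p : 'I_k * R, exists y, exists n, (p.2, y) \in s n p.1.
  by move=> [i x]; have [n [y h]] := tot (i, true) x; exists y, n.
have /choice[g hg] : forall p : 'I_k * R, exists y, exists n, (y, p.2) \in s n p.1.
  by move=> [i x]; have [n [y h]] := tot (i, false) x; exists y, n.
have fE n i x y : (x, y) \in s n i -> f (i, x) = y.
  have [m /= h h'] := hf (i, x).
  by have [/= /esym] := iso _ _ _ _ _ h h'; rewrite eqxx => /eqP.
have fgK i : cancel (fun x => f (i, x)) (fun x => g (i, x)).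
  move=> x; have [m /= h] := hf (i, x); have [n /= h'] := hg (i, f (i, x)).
  by have [/=] := iso _ _ _ _ _ h' h; rewrite eqxx => /eqP.
have gfK i : cancel (fun x => g (i, x)) (fun x => f (i, x)).
  by move=> x; have [n /= /fE] := hg (i, x).
have fA i x y : adj (f (i, x)) (f (i, y)) = adj x y.
  have [m /= h] := hf (i, x); have [n /= h'] := hf (i, y).
  by have [] := iso _ _ _ _ _ h h'.
by exists (fun i => mk_aut (Bijective (fgK i) (gfK i)) (fA i)) => n i x y /fE.
Qed.

Lemma aut_fun1 x : aut_fun (1%g : Aut R) x = x.
Proof. by []. Qed.

Lemma aut_funM (g h : Aut R) x : aut_fun (g * h)%g x = aut_fun g (aut_fun h x).
Proof. by []. Qed.

Lemma aut_funV (g : Aut R) x y : aut_fun g^-1%g x = y <-> aut_fun g y = x.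
Proof.
by split=> <-; rewrite -aut_funM ?mulgV ?mulVg.
Qed.

Lemma spath_eval (S : state R k) (b : 'I_k -> Aut R) :
  (forall i x y, (x, y) \in S i -> aut_fun (b i) x = y) ->
  forall t x y, spath S t x y -> aut_fun (eval_word b t) x = y.
Proof.
move=> hb; elim=> [|[i c] t IH] x y /=; rewrite /eval_word.
  by rewrite big_nil => <-.
move=> [z /IH h hz]; rewrite big_cons aut_funM h /=.
by case: c hz => /hb // /aut_funV.
Qed.

End Limit.

(** * Words in groups and free bases *)

Section Words.
Variables (T : groupType) (k : nat) (a : 'I_k -> T).
Implicit Types (t u : word k) (l m : 'I_k * bool).

Lemma eval_word_cat t u :
  eval_word a (t ++ u) = (eval_word a t * eval_word a u)%g.
Proof. exact: big_cat. Qed.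

Lemma eval_word_cons l t :
  eval_word a (l :: t) = (eval_word a [:: l] * eval_word a t)%g.
Proof. exact: eval_word_cat [:: l] t. Qed.

Lemma eval_word_flip l : eval_word a [:: flip l] = (eval_word a [:: l])^-1%g.
Proof. by rewrite /eval_word !big_seq1; case: l => i [] //=; rewrite invgK. Qed.

Lemma winv_cons l t : winv (l :: t) = winv t ++ [:: flip l].
Proof. by rewrite /winv /= rev_cons cats1. Qed.

Lemma eval_winv t : eval_word a (winv t) = (eval_word a t)^-1%g.
Proof.
elim: t => [|l t IH]; first by rewrite /winv /eval_word big_nil invg1.
by rewrite winv_cons eval_word_cat IH eval_word_flip [in RHS]eval_word_cons invgM.
Qed.

Lemma generatedP g : generated a g <-> exists t, eval_word a t = g.
Proof.
split=> [|[t <-] H [[H1 HV] aH]].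
  move/(_ [set h | exists t, eval_word a t = h]); apply; split.
    split=> [|_ _ [t <-] [u <-]]; first by exists [::]; rewrite /eval_word big_nil.
    by exists (t ++ winv u); rewrite eval_word_cat eval_winv.
  by move=> _ [i _ <-]; exists [:: (i, true)]; rewrite /eval_word big_seq1.
have HI x : H x -> H x^-1%g by move=> Hx; rewrite -[x^-1%g]mul1g; exact: HV.
elim: t => [|[i b] t IH]; first by rewrite /eval_word big_nil.
rewrite eval_word_cons -[eval_word a t]invgK; apply: (HV); last exact: HI.
have Hi : H (a i) by apply: aH; exists i.
by rewrite /eval_word big_seq1; case: b => //=; exact: HI.
Qed.

Lemma eval_reduced t : exists2 u, reduced u & eval_word a u = eval_word a t.
Proof.
elim: t => [|l t [u ru ut]]; first by exists [::].
rewrite eval_word_cons -ut.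
case: u ru {ut} => [|m u] ru; first by exists [:: l]; rewrite // {1}eval_word_cons.
have [lm|lm] := boolP ((l.1 == m.1) && (l.2 != m.2)); last first.
  by exists (l :: m :: u); [rewrite /reduced /= lm; exact: ru|rewrite eval_word_cons].
have {lm} -> : l = flip m.
  by case: l m {ru} lm => i b [j c] /= /andP[/eqP -> bc]; case: b c bc => [] [].
exists u; first exact: path_sorted ru.
by rewrite [eval_word a (m :: u)]eval_word_cons eval_word_flip mulKg.
Qed.

Lemma reduced_cat t l m u : reduced (rcons t l) -> reduced (m :: u) ->
  ~~ ((l.1 == m.1) && (l.2 != m.2)) -> reduced (rcons t l ++ m :: u).
Proof.
move=> rt ru lm; elim: t rt => [|n [|p t] IH] /=; first by rewrite /reduced /= lm.
  by rewrite /reduced /= => /andP[-> _]; rewrite lm.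
by move=> /andP[h rt]; apply/andP; split=> //; exact: IH.
Qed.

Lemma reduced_winv t : reduced t -> reduced (winv t).
Proof.
elim: t => [//|l [|m t] IH] //.
move=> /andP[lm /IH]; rewrite !winv_cons !cats1 => rt.
rewrite -cats1; apply: reduced_cat => //=.
by rewrite eq_sym (inj_eq negb_inj) (eq_sym m.2).
Qed.

(** If two distinct reduced words have equal values, strip their common first letters: the inverse
    of one followed by the other is reduced, nonempty and of value 1. *)
Lemma free_with_basisP :
  free_with_basis a <->
  forall t, reduced t -> t != [::] -> eval_word a t <> 1%g.
Proof.
split=> [fa t rt /eqP t0 t1|ht].
  have [|u [_ uP]] := fa 1%g; first by apply/generatedP; exists t.
  have e0 : eval_word a [::] = 1%g by rewrite /eval_word big_nil.
  by apply: t0; rewrite -(uP t) // (uP [::]).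
have e0 : eval_word a [::] = 1%g by rewrite /eval_word big_nil.
move=> _ /generatedP[t0 <-]; have [t rt <-] := eval_reduced t0.
exists t; split=> // u [ru]; elim: t u rt ru => [|l t IH] [|m u] // rt ru.
- by rewrite e0 => /ht -/(_ ru isT).
- by rewrite e0 => /esym/ht -/(_ rt isT).
have [->|lm] := eqVneq l m.
  rewrite (eval_word_cons m t) (eval_word_cons m u) => /mulgI h; congr (_ :: _).
  by apply: IH h; [exact: path_sorted rt|exact: path_sorted ru].
move=> E; exfalso; apply: (ht (winv (m :: u) ++ (l :: t))).
- have := reduced_winv ru; rewrite winv_cons cats1 => h; apply: reduced_cat => //=.
  apply: contra lm => /andP[/eqP e1].
  by case: l m e1 {rt ru E h} => i b [j c] /= ->; rewrite xpair_eqE eqxx; case: b c => [] [].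
- by rewrite winv_cons; case: (winv u).
- by rewrite eval_word_cat eval_winv E mulVg.
Qed.

End Words.

(** * The topology of pointwise convergence *)

Section Topology.

Lemma open_ptws_proj (I : eqType) (T : topologicalType) (i : I) (C : set T) :
  open C -> open [set f : {ptws I -> T} | C (f i)].
Proof.
have /(@continuousP {ptws I -> T} T (fun f => f i)) h :=
  @proj_continuous I (fun=> T) i.
exact: h.
Qed.

Variables (R : graph) (k : nat).

(** Splitting over the image [z] of [x] under the tail of the word leaves conditions on single
    generators; an inverse letter is a condition on its generator with the two vertices
    exchanged. *)
Lemma open_eval_word (t : word k) (x y : R) :
  open [set a : Aut_power R k | aut_fun (eval_word a t) x = y].
Proof.
have open_gen i z u : open [set a : Aut_power R k | aut_fun (a i) z = u].
  have oD : open [set f : {ptws R -> discrete_topology R} | [set u] (f z)].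
    by apply: open_ptws_proj; exact: discrete_open.
  have oA : open [set g : Aut R | aut_fun g z = u] by exists [set f | f z = u].
  exact: open_ptws_proj oA.
elim: t y => [|[i b] t IH] y.
  rewrite /eval_word; under eq_set do rewrite big_nil aut_fun1.
  have [->|xy] := eqVneq x y.
    by rewrite (_ : [set _ | _] = setT) ?predeqE //; exact: openT.
  rewrite (_ : [set _ | _] = set0); first exact: open0.
  by rewrite predeqE => a; split=> // /eqP; rewrite (negPf xy).
rewrite (_ : [set _ | _] = \bigcup_z ([set a | aut_fun (eval_word a t) x = z] `&`
    [set a : Aut_power R k | if b then aut_fun (a i) z = y else aut_fun (a i) y = z])).
  by apply: bigcup_open => z _; apply: openI => //; case: b.
rewrite predeqE => a /=; rewrite eval_word_cons aut_funM /eval_word big_seq1 /=.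
split=> [E|[z _ [<-]]].
  by exists (aut_fun (eval_word a t) x) => //; split=> //; case: b E => // /aut_funV.
by case: b => //= /aut_funV.
Qed.

(** Agreement with [f] on finite lists generates a filter that converges to [f] in each coordinate,
    hence in the product topology. *)
Lemma open_ptws_agree (C : set {ptws R -> discrete_topology R}) f :
  open C -> C f ->
  exists pts : seq R, forall g, {in pts, g =1 f} -> C g.
Proof.
move=> oC Cf.
pose F := filter_from [set: seq R]
  (fun pts => [set g : {ptws R -> discrete_topology R} | {in pts, g =1 f}]).
have FF : Filter F.
  apply: filter_from_filter; first by exists [::].
  move=> s t _ _; exists (s ++ t) => // g gst.
  by split=> x xs; apply: gst; rewrite mem_cat xs ?orbT.
suff [s _ sC] : F C by exists s.
have : F --> f.
  apply/cvg_sup => x B [_ [[D oD <-] Df] DB]; exists [:: x] => // g gx.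
  by apply: DB; rewrite /= gx ?mem_head.
by apply; exact: open_nbhs_nbhs.
Qed.

Lemma open_power_agree (C : set (Aut_power R k)) a :
  open C -> C a ->
  exists pts : seq R, forall b : Aut_power R k,
    (forall i, {in pts, aut_fun (b i) =1 aut_fun (a i)}) -> C b.
Proof.
move=> oC Ca.
pose F := filter_from [set: seq R] (fun pts => [set b : Aut_power R k |
  forall i, {in pts, aut_fun (b i) =1 aut_fun (a i)}]).
have FF : Filter F.
  apply: filter_from_filter; first by exists [::].
  move=> s t _ _; exists (s ++ t) => // g gst.
  by split=> i x xs; apply: gst; rewrite mem_cat xs ?orbT.
suff [s _ sC] : F C by exists s.
have : F --> a.
  apply/cvg_sup => i B [_ [[D [E oE <-] <-] Df] DB].
  have [s sE] := open_ptws_agree oE Df.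
  by exists s => // g gs; apply: DB; apply: sE; exact: gs.
by apply; exact: open_nbhs_nbhs.
Qed.

End Topology.

(** * Countably many open requirements, and tuples meeting them *)

Section Generic.
Variables (R : graph) (k : nat).
Hypothesis hR : is_random_graph R.
Implicit Types (a b : Aut_power R k) (ps : seq (R * R)) (t : word k).

Definition realizes a ps t : Prop :=
  forall p, p \in ps -> aut_fun (eval_word a t) p.1 = p.2.

Lemma homogeneousP a : homogeneous (generated a) <->
  forall ps, partial_iso ps -> exists t, realizes a ps t.
Proof.
split=> [ha ps hps|ha U W phi finU _ [_ phiI _] phiA].
  (* A state with a single generator turns the list into a function, extended by the identity. *)
  pose phi x := odflt x (peval (fun _ : 'I_1 => ps) ord0 x).
  have phiE p : p \in ps -> phi p.1 = p.2.
    case: p => x y /= xy; rewrite /phi.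
    by have /(pevalP (S := fun _ : 'I_1 => ps) (fun=> hps)) -> : (x, y) \in ps.
  have [||||_ /generatedP[t <-] gP] := ha [set` unzip1 ps] [set` unzip2 ps] phi.
  - exact: finite_seq.
  - exact: finite_seq.
  - split.
    + by move=> _ /mapP[p pp ->]; rewrite phiE //; exact: map_f.
    + move=> _ _ /set_mem/mapP[p pp ->] /set_mem/mapP[q qp ->]; rewrite !phiE //.
      by have [h _] := hps _ _ pp qp => pq; apply/eqP; rewrite h pq.
    + by move=> _ /mapP[p pp ->]; exists p.1; rewrite ?phiE //; exact: map_f.
  - move=> _ _ /mapP[p pp ->] /mapP[q qp ->]; rewrite !phiE //.
    by have [_ ->] := hps _ _ pp qp.
  by exists t => p pp; rewrite gP ?phiE //; exact: map_f.
have [s sU] : exists s : seq R, U = [set` s] by exact/finite_seqP.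
have [|t tP] := ha [seq (x, phi x) | x <- s].
  move=> _ _ /mapP[x xs ->] /mapP[y ys ->] /=.
  have xU : U x by rewrite sU.
  have yU : U y by rewrite sU.
  by rewrite phiA //; split=> //; rewrite (inj_in_eq phiI) ?inE.
exists (eval_word a t); first by apply/generatedP; exists t.
move=> u; rewrite sU => us.
by apply: (tP (u, phi u)); apply/mapP; exists u.
Qed.

Lemma homogeneous_orbits a :
  homogeneous (generated a) -> all_orbits_infinite (generated a).
Proof.
move=> /homogeneousP ha x; have [_ iR _] := hR.
apply: sub_infinite_set iR => y _.
have [|t /(_ (x, y)) tP] := ha [:: (x, y)].
  by move=> p q; rewrite !inE => /eqP -> /eqP ->; rewrite !eqxx !adj_irr.
exists (eval_word a t); first by apply/generatedP; exists t.
by apply: tP; rewrite inE.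
Qed.

Lemma open_realizes ps t : open [set a : Aut_power R k | realizes a ps t].
Proof.
elim: ps => [|p ps IH].
  by rewrite (_ : [set _ | _] = setT) ?predeqE //; exact: openT.
rewrite (_ : [set _ | _] =
    [set a | aut_fun (eval_word a t) p.1 = p.2] `&` [set a | realizes a ps t]).
  by apply: openI => //; exact: open_eval_word.
rewrite predeqE => a; split=> /= [h|[h hs] q]; last first.
  by rewrite inE => /predU1P[->|/hs].
by split=> [|q qs]; apply: h; rewrite inE ?eqxx ?qs ?orbT.
Qed.

Lemma open_word_neq1 t :
  open [set a : Aut_power R k | eval_word a t <> 1%g].
Proof.
rewrite (_ : [set _ | _] = \bigcup_(p in [set p : R * R | p.1 <> p.2])
    [set a | aut_fun (eval_word a t) p.1 = p.2]).
  by apply: bigcup_open => p _; exact: open_eval_word.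
rewrite predeqE => a; split=> /= [h|[p hp pE] a1]; last first.
  by apply: hp; rewrite -pE a1.
apply: contrapT => N; apply: h; apply: aut_eq => x; apply: contrapT => xN.
by apply: N; exists (x, aut_fun (eval_word a t) x) => // /esym.
Qed.

(** Coding vertices by numbers makes the requirements countable; numbers that code nothing are sent
    to a default vertex. *)
Lemma vertex_enumeration : exists (e : nat -> R) (f : R -> nat), cancel f e.
Proof.
have [/countable_injP[f fI] iR _] := hR.
have [x0 _] := infinite_setN0 iR.
have /choice[e he] n : exists x, forall y, f y = n -> y = x.
  have [[x <-]|N] := pselect (exists x, f x = n).
    by exists x => y; apply: fI; rewrite inE.
  by exists x0 => y yn; case: N; exists y.
by exists e, f => x; rewrite -(he (f x) x).
Qed.

Lemma restriction_admissible (i0 : 'I_k) a (pts : seq R) : calA a ->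
  admissible (fun i => [seq (x, aut_fun (a i) x) | x <- pts]).
Proof.
move=> aA; pose S i := [seq (x, aut_fun (a i) x) | x <- pts].
have aI i : injective (aut_fun (a i)) by exact: bij_inj (aut_bij _).
have SP i x y : (x, y) \in S i <-> x \in pts /\ aut_fun (a i) x = y.
  split=> [/mapP[z zp [-> ->]]//|[xp <-]].
  by apply/mapP; exists x.
split=> [i|x].
  by move=> _ _ /mapP[x _ ->] /mapP[y _ ->] /=; rewrite aut_adj (inj_eq (aI i)).
apply: contrapT => N.
have reach w : exists y, ppath S w x y.
  by apply: contrapT => M; apply: N; exists w => y xy; apply: M; exists y.
(* If no positive word leaves from [x], the points reached from [x] form a finite set. *)
pose Y := [seq y <- undup pts | `[< exists w, ppath S w x y >]].
have pcat w w' u v z : ppath S w u v -> ppath S w' v z -> ppath S (w ++ w') u z.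
  elim: w u => [|i w IH] u /=; first by move=> ->.
  by move=> [r ur rv] vz; exists r => //; exact: IH.
have pfun w u v v' : ppath S w u v -> ppath S w u v' -> v = v'.
  elim: w u => [|i w IH] u /=; first by move=> <-.
  by move=> [r /SP[_ <-] /IH h] [r' /SP[_ <-] /h].
have YP y : y \in Y <-> exists w, ppath S w x y.
  rewrite mem_filter mem_undup; split=> [/andP[/asboolP//]|[w xy]].
  apply/andP; split; first by apply/asboolP; exists w.
  (* One more letter is defined at [y], which puts [y] in [pts]. *)
  have [_ /ppath_cat[y' xy' /= [r /SP[yp _] _]]] := reach (w ++ [:: i0]).
  by rewrite (pfun _ _ _ _ xy xy').
have YI i : map (aut_fun (a i)) Y =i Y.
  have YY : {subset map (aut_fun (a i)) Y <= Y}.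
    move=> _ /mapP[y /YP[w xy] ->]; apply/YP; exists (w ++ [:: i]).
    have [z /ppath_cat[y' xy' /= [r yr _]]] := reach (w ++ [:: i]).
    apply: (pcat _ _ _ _ _ xy); exists (aut_fun (a i) y) => //.
    by rewrite (pfun _ _ _ _ xy xy'); apply/SP; case/SP: yr.
  (* An injective self-map of a finite set is onto, so [Y] is invariant under inverses as well and
     contains the orbit of [x]. *)
  have [||] := uniq_min_size _ YY; rewrite ?size_map ?(map_inj_uniq (aI i)) //.
  by rewrite filter_uniq ?undup_uniq.
have : generated a `<=` [set g | forall y, (aut_fun g y \in Y) = (y \in Y)].
  move=> g /(_ _); apply; split; last first.
    by move=> _ [i _ <-] y; rewrite -[LHS](YI i) (mem_map (aI i)).
  split=> [//|g1 g2 h1 h2 y]; rewrite aut_funM h1 -h2.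
  by rewrite -aut_funM mulgV.
move=> gY; apply: (aA x); apply: sub_finite_set (finite_seq Y).
by move=> _ [g /gY gx <-] /=; rewrite gx; apply/YP; exists [::].
Qed.

Definition free_homogeneous a : Prop :=
  (forall t, reduced t -> t != [::] -> eval_word a t <> 1%g) /\
  (forall ps, partial_iso ps -> exists t, realizes a ps t).

Lemma free_homogeneousP a : free_homogeneous a <->
  [/\ free_with_basis a, homogeneous (generated a)
    & all_orbits_infinite (generated a)].
Proof.
split=> [[fa ha]|[/free_with_basisP fa /homogeneousP ha _]]; last by split.
have ha' : homogeneous (generated a) by exact/homogeneousP.
by split=> //; [exact/free_with_basisP|exact: homogeneous_orbits].
Qed.

Lemma free_homogeneous_open : exists2 F : nat -> set (Aut_power R k),
  (forall n, open (F n)) & [set a | free_homogeneous a] = \bigcap_n F n.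
Proof.
have [e [f fK]] := vertex_enumeration.
pose dec (p : nat * nat) := (e p.1, e p.2).
pose enc (p : R * R) := (f p.1, f p.2).
have encK : cancel enc dec by case=> x y; rewrite /dec /= !fK.
(* Vacuous requirements and numbers without a code give the whole space. *)
pose F n : set (Aut_power R k) :=
  match unpickle n : option (seq (nat * nat) + word k) with
  | Some (inl ps) => [set a | partial_iso (map dec ps) ->
                               exists t, realizes a (map dec ps) t]
  | Some (inr t) => [set a | reduced t -> t != [::] -> eval_word a t <> 1%g]
  | None => setT
  end.
exists F => [n|].
  rewrite /F; case: unpickle => [[ps|t]|]; last exact: openT.
    have [h|h] := pselect (partial_iso (map dec ps)); last first.
      rewrite (_ : [set _ | _] = setT); first exact: openT.
      by rewrite predeqE => a; split=> // _ /h.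
    rewrite (_ : [set _ | _] = \bigcup_t [set a | realizes a (map dec ps) t]).
      by apply: bigcup_open => t _; exact: open_realizes.
    rewrite predeqE => a; split=> [/(_ h)[t ht]|[t _ ht] _]; last by exists t.
    by exists t.
  have [/andP[rt t0]|h] := boolP (reduced t && (t != [::])); last first.
    rewrite (_ : [set _ | _] = setT); first exact: openT.
    by rewrite predeqE => a; split=> // _ rt t0; rewrite rt t0 in h.
  rewrite (_ : [set _ | _] = [set a | eval_word a t <> 1%g]).
    exact: open_word_neq1.
  by rewrite predeqE => a; split=> [/(_ rt t0)|h _ _].
rewrite predeqE => a; split=> [[fa ha] n _|ha].
  rewrite /F; case: unpickle => [[ps|t]|] //; first exact: ha.
  exact: fa.
split=> [t|ps].
  by have := ha (pickle (inr t : seq (nat * nat) + word k)) I; rewrite /F pickleK.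
have := ha (pickle (inl (map enc ps) : seq (nat * nat) + word k)) I.
by rewrite /F pickleK (mapK encK).
Qed.

Lemma admissible_extends (i1 i2 : 'I_k) (S : state R k) : i1 != i2 ->
  admissible S ->
  exists a : Aut_power R k, free_homogeneous a /\
    forall i x y, (x, y) \in S i -> aut_fun (a i) x = y.
Proof.
move=> i12 aS; have [e [f fK]] := vertex_enumeration.
pose dec (p : nat * nat) := (e p.1, e p.2).
pose enc (p : R * R) := (f p.1, f p.2).
have encK : cancel enc dec by case=> x y; rewrite /dec /= !fK.
(* Three kinds of requirements: a letter defined at a vertex, a finite partial isomorphism realized,
   a word made nontrivial. Requirement [n] is met by state [n.+1]. *)
pose req := (('I_k * bool) * nat + (seq (nat * nat) + word k))%type.
pose P n (S' : state R k) :=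
  match unpickle n : option req with
  | Some (inl (l, m)) => exists y, sstep S' l (e m) y
  | Some (inr (inl ps)) => partial_iso (map dec ps) ->
      exists t, forall p, p \in map dec ps -> spath S' t p.1 p.2
  | Some (inr (inr t)) => reduced t -> t != [::] ->
      exists x y, spath S' t x y /\ x != y
  | None => True
  end.
have [|s [s0 sS sA sP]] := generic_chain (P := P) _ aS.
  move=> n S1 aS1; rewrite /P.
  case: unpickle => [[[l m]|[ps|t]]|].
  - exact: step_extension.
  - have [h|h] := pselect (partial_iso (map dec ps)).
      have [S2 [? ? h2]] := homogeneous_extension hR i12 aS1 h.
      by exists S2; split.
    by exists S1; split=> // i x.
  - have [/andP[rt t0]|h] := boolP (reduced t && (t != [::])).
      have [S2 [? ? h2]] := free_extension hR aS1 rt t0.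
      by exists S2; split.
    by exists S1; split=> [i x| |rt t0] //; rewrite rt t0 in h.
  - by exists S1; split=> // i x.
have [|a aE] := chain_limit sS sA.
  move=> l x; pose n := pickle (inl (l, f x) : req).
  exists n.+1; have := sP n; rewrite /P /n pickleK fK.
  by case=> y ?; exists y.
have aP n t x y : spath (s n) t x y -> aut_fun (eval_word a t) x = y.
  by apply: spath_eval; exact: aE.
exists a; split=> [|i x y xy]; last by apply: (aE 0); rewrite s0.
split=> [t rt t0|ps hps].
  have := sP (pickle (inr (inr t) : req)); rewrite /P pickleK.
  move=> /(_ rt t0)[x [y [/aP xy /eqP nxy]]] t1; apply: nxy.
  by rewrite -xy t1.
have := sP (pickle (inr (inl (map enc ps)) : req)); rewrite /P pickleK.
rewrite (mapK encK) => /(_ hps)[t ht]; exists t => p /ht; exact: aP.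
Qed.

End Generic.

Theorem theoremD (R : graph) (hR : is_random_graph R)
    (k : nat) (hk : (2 <= k)%N) :
  dense_Gdelta_in (@calA R k)
    [set alpha : Aut_power R k |
      [/\ free_with_basis alpha,
          homogeneous (generated alpha)
        & all_orbits_infinite (generated alpha)]].
Proof.
(* These are the indices 0 and 1, since [2 <= k] unfolds to [1 < k]. *)
pose i1 := Ordinal (ltnW hk); pose i2 := Ordinal hk.
have i12 : i1 != i2 by [].
split=> [a [] //|O [a Oa] [C oC CO]|].
- have Ca : C (set_val a) by move: Oa; rewrite -CO.
  (* Agreement with [a] on [pts] ensures membership in [C], so every generic extension of the
     restriction of [a] to [pts] lies in [C]. *)
  have [pts ptsC] := open_power_agree oC Ca.
  have aA : calA (set_val a) by exact: set_valP.
  have [b [bP bE]] := admissible_extends hR i12 (restriction_admissible i1 pts aA).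
  have bS := (free_homogeneousP hR b).1 bP.
  have bA : calA b by case: bS.
  exists (exist _ b (mem_set bA)); split=> //.
  rewrite -CO; apply: ptsC => i x xp; apply: bE.
  by apply/mapP; exists x.
- have [F oF FE] := @free_homogeneous_open R k hR.
  exists (fun n => set_val @^-1` F n) => [n|]; first by exists (F n).
  rewrite -preimage_bigcap -FE; congr (_ @^-1` _).
  by rewrite predeqE => a; rewrite /= free_homogeneousP.
Qed.
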